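(* Let $C$ be a nonempty closed convex subset of a real Hilbert space $\mathcal{H}$, let $\phi:C\times C\to\mathbb{R}$ be such that $\phi(x,\cdot)$ is convex for every $x\in C$, let $\varphi:C\to\mathbb{R}$ be convex, and let $f(x,y):=\phi(x,y)+\varphi(y)-\varphi(x)$ for $x,y\in C$. Suppose that $\phi$ is monotone on $C$ and satisfies the strongly Lipschitz-type condition on $C$. Then for every $\epsilon>0$ there exists $\lambda>0$ such that the proximal mapping $B_\lambda$ of $f$ is $\epsilon$-nonexpansive on $C$, i.e. $$\|B_\lambda(x)-B_\lambda(y)\|^2\le(1+\epsilon)\|x-y\|^2\qquad\text{for all } x,y\in C.$$
   Context: $\langle\cdot,\cdot\rangle$ and $\|\cdot\|$ denote the inner product and induced norm of $\mathcal{H}$. For $\lambda>0$ and $x\in C$ the proximal mapping $B_\lambda:C\to C$ is $$B_\lambda(x):=\operatorname{argmin}\left\{\lambda f(x,y)+\tfrac12\|y-x\|^2 : y\in C\right\}.$$ Standing assumptions: either $C$ has an interior point or, for every $x\in C$, $\phi(x,\cdot)$ is continuous with respect to $C$ at some point of $C$; and the strongly convex problem defining $B_\lambda(x)$ has a (necessarily unique) minimizer for every $x\in C$ and $\lambda>0$, so that $B_\lambda$ is a well-defined single-valued map. $\phi$ is monotone on $C$ if $\phi(x,y)+\phi(y,x)\le 0$ for all $x,y\in C$. $\phi$ is strongly Lipschitz-type on $C$ if there exist an integer $p\ge1$, maps $\alpha_i:C\times C\to\mathcal{H}$ and $\beta_i:C-C\to\mathcal{H}$ (where $C-C=\{u-v:u,v\in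 C\}$), and constants $K_i,L_i>0$, $i=1,\dots,p$, such that $$\phi(x,y)+\phi(y,z)\ge\phi(x,z)+\sum_{i=1}^p\langle\alpha_i(x,y),\beta_i(y-z)\rangle\quad\text{for all } x,y,z\in C,$$ and, for every $i=1,\dots,p$: $\|\beta_i(u)-\beta_i(v)\|\le K_i\|u-v\|$ for all $u,v\in C-C$; $\|\alpha_i(x,y)\|\le L_i\|x-y\|$ for all $x,y\in C$; and $\alpha_i(x,y)+\alpha_i(y,x)=0$ for all $x,y\in C$. *)

(* Defs.v *)
From HB Require Import structures.
From mathcomp Require Export all_boot all_order all_algebra.
From mathcomp Require Export sesquilinear.
From mathcomp Require Export boolp classical_sets reals topology normedtype convex.
Export numFieldNormedType.Exports.

Set Implicit Arguments.
Unset Strict Implicit.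
Unset Printing Implicit Defensive.

Import Order.TTheory GRing.Theory Num.Theory.

Local Open Scope classical_set_scope.
Local Open Scope ring_scope.

(* Maps with domain C, C x C or C - C are encoded as total maps on the ambient
   space; every definition below only uses their values on that domain. *)

Section EquilibriumProblems.
Context {R : realType} {H : completeNormedModType R}.
Implicit Types (C : set H) (phi f : H -> H -> R).

(* The Hilbert structure: [dot] is a symmetric positive definite bilinear form
   inducing the norm of the (complete) space H. *)
Definition induces_norm (dot : {dot H for idfun}) : Prop :=
  forall u : H, `|u| = Num.sqrt (dot u u).

Definition argmin C (g : H -> R) : set H :=
  [set y | C y /\ forall z, C z -> g y <= g z].

Definition prox_objective f (lambda : R) (x y : H) : R :=
  lambda * f x y + 2^-1 * `|y - x| ^+ 2.

(* When f x is convex on C the objective is strongly convex, so argmin has at most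
   one point: prox selects the minimizer if it exists, and the junk value x
   otherwise. *)
Definition prox C f (lambda : R) (x : H) : H :=
  xget x (argmin C (prox_objective f lambda x)).

Definition monotone_bifun C phi : Prop :=
  forall x y, C x -> C y -> phi x y + phi y x <= 0.

Definition continuous_wrt_at C (g : H -> R) (z : H) : Prop :=
  g @ within C (nbhs z) --> g z.

Definition strongly_lipschitz_type (dot : {dot H for idfun}) C phi : Prop :=
  exists (p : nat) (alpha : 'I_p -> H -> H -> H) (beta : 'I_p -> H -> H)
         (K L : 'I_p -> R),
    [/\ (1 <= p)%N,
        forall i, 0 < K i /\ 0 < L i,
        forall x y z, C x -> C y -> C z ->
          phi x z + \sum_(i < p) dot (alpha i x y) (beta i (y - z))
            <= phi x y + phi y z
      & forall i,
        [/\ (K i).-lipschitz_[set u - v | u in C & v in C] (beta i),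
            forall x y, C x -> C y -> `|alpha i x y| <= L i * `|x - y|
          & forall x y, C x -> C y -> alpha i x y + alpha i y x = 0]].

Definition eps_nonexpansive C (eps : R) (T : H -> H) : Prop :=
  forall x y, C x -> C y -> `|T x - T y| ^+ 2 <= (1 + eps) * `|x - y| ^+ 2.

End EquilibriumProblems.

(* Main.v *)
Require Import Defs.
From mathcomp Require Import all_boot all_order all_algebra.
From mathcomp Require Import sesquilinear.
From mathcomp Require Import boolp classical_sets reals topology normedtype convex.
From mathcomp Require Import interval_inference unstable ring lra.

Set Implicit Arguments.
Unset Strict Implicit.
Unset Printing Implicit Defensive.

Import Order.TTheory GRing.Theory Num.Theory.
Import numFieldNormedType.Exports.

Local Open Scope classical_set_scope.
Local Open Scope ring_scope.

(** Fix [x] and [y] in [C] and write [a] and [b] for their proximal images, and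
    [u], [v], [w] for the norms of [x - y], [a - b] and [(x - y) - (a - b)].

    Convexity turns the minimality of [a] and [b] into variational inequalities
    ([argmin_prox_variational]). Testing the one at [a] with [b], the one at [b]
    with [a], and adding them gives
      [v^2 <= <x - y, a - b> + lambda * D],
    where [D = phi x b - phi x a + phi y a - phi y b]
    ([sqr_dist_argmin_prox]); the terms in [varphi] cancel.

    The Lipschitz-type inequality, used for the triples [(x, y, b)] and
    [(y, x, a)], together with the antisymmetry of the [alpha_i], bounds [D] by
    [phi x y + phi y x - sum_i <alpha_i x y, beta_i (y - b) - beta_i (x - a)>].
    Monotonicity discards the first two terms, and Cauchy-Schwarz bounds the
    rest by [M * u * w] with [M = sum_i L_i K_i]
    ([strongly_lipschitz_type_bound]).

    The quantity [w] is not small, but polarization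
      [2 <x - y, a - b> = u^2 + v^2 - w^2]
    supplies a term [- w^2] which absorbs it:
      [v^2 <= u^2 - w^2 + 2 lambda M u w <= (1 + (lambda M)^2) u^2].
    Hence [lambda = sqrt eps / M] is a suitable choice. *)

Section InducedNorm.
Context {R : realType} {H : completeNormedModType R}.
Variables (dot : {dot H for idfun}) (dot_norm : induces_norm dot).
Implicit Types u v : H.

Lemma dotC u v : dot u v = dot v u.
Proof. by rewrite (hermC dot) expr0 mul1r. Qed.

Lemma dot_ge0 u : 0 <= dot u u.
Proof.
have [->|u_neq0] := eqVneq u 0; first by rewrite linear0r.
exact/ltW/neq0_dnorm_gt0.
Qed.

Lemma sqr_norm_dot u : `|u| ^+ 2 = dot u u.
Proof. by rewrite dot_norm sqr_sqrtr // dot_ge0. Qed.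

Lemma sqr_normD u v :
  `|u + v| ^+ 2 = `|u| ^+ 2 + 2 * dot u v + `|v| ^+ 2.
Proof. by rewrite !sqr_norm_dot hnormD /=; ring. Qed.

Lemma sqr_normB u v :
  `|u - v| ^+ 2 = `|u| ^+ 2 - 2 * dot u v + `|v| ^+ 2.
Proof. by rewrite !sqr_norm_dot hnormB /=; ring. Qed.

(** Cauchy-Schwarz is free here: the norm satisfies the triangle inequality by
    assumption, and squaring it leaves exactly this inequality. *)
Lemma dot_le_norm u v : dot u v <= `|u| * `|v|.
Proof.
have := sqr_normD u v.
have : `|u + v| ^+ 2 <= (`|u| + `|v|) ^+ 2.
  by rewrite ler_sqr ?nnegrE ?addr_ge0 // ler_normD.
by rewrite sqrrD; lra.
Qed.

End InducedNorm.

(** The limit [t -> 0] in first-order optimality conditions, for a remainder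
    that is linear in [t]. *)
Lemma ge0_of_affine_ge0 (R : realFieldType) (A B : R) :
  (forall t, 0 < t -> t <= 1 -> 0 <= A + t * B) -> 0 <= A.
Proof.
move=> AB_ge0; rewrite leNgt; apply/negP => A_lt0.
have B_ge : - A <= B by have := AB_ge0 1 ltr01 (lexx _); lra.
have B_gt0 : 0 < B by lra.
(* At t = - A / (2 B) the affine expression equals A / 2. *)
have tE : - A / (2 * B) * B = - A / 2 by field; lra.
suff : 0 <= A + - A / (2 * B) * B by rewrite tE; lra.
apply: AB_ge0; first by rewrite divr_gt0//; lra.
by rewrite ler_pdivrMr; lra.
Qed.

Section Proximal.
Context {R : realType} {H : completeNormedModType R}.
Variables (dot : {dot H for idfun}) (dot_norm : induces_norm dot).
Variables (C : set H) (C_convex : convex_set C).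

(** First-order optimality: the objective at [a] is compared with its value at
    [a + t (z - a)]. Convexity of [f x] bounds the increment by [t] times the
    right-hand side below plus [t^2 / 2 * |z - a|^2]; divide by [t] and let
    [t] tend to 0. *)
Lemma argmin_prox_variational (f : H -> H -> R) (lambda : R) (x a z : H) :
  0 <= lambda -> convex_function C (f x) ->
  argmin C (prox_objective f lambda x) a -> C z ->
  0 <= lambda * (f x z - f x a) + dot (a - x) (z - a).
Proof.
move=> lambda_ge0 f_convex [Ca a_min] Cz.
suff segment_ge0 (t : R) : 0 < t -> t <= 1 ->
    0 <= lambda * (f x z - f x a) + dot (a - x) (z - a)
         + t * (2^-1 * `|z - a| ^+ 2).
  exact: ge0_of_affine_ge0 segment_ge0.
move=> t_gt0 t_le1.
pose s : {i01 R} := Itv01 (ltW t_gt0) t_le1.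
have zE : conv s (z : convex_lmodType H) a = a + t *: (z - a).
  rewrite [LHS]/(t *: z + (1 - t) *: a).
  by rewrite scalerBl scalerBr scale1r addrCA.
have Czt : C (a + t *: (z - a)).
  by rewrite -zE; apply/set_mem/C_convex; apply: mem_set.
have := f_convex s z a (mem_set Cz) (mem_set Ca).
rewrite zE convRE /= /onem => f_le.
have := a_min _ Czt; rewrite /prox_objective.
have -> : a + t *: (z - a) - x = (a - x) + t *: (z - a) by rewrite addrAC.
rewrite (sqr_normD dot_norm (a - x)) linearZr_LR /=.
rewrite normrZ (ger0_norm (ltW t_gt0)) exprMn.
have := ler_wpM2l lambda_ge0 f_le.
set A := dot _ _; set N := `|z - a| ^+ 2; set P := `|a - x| ^+ 2 => le1 le2.
rewrite -(pmulr_rge0 _ t_gt0); nra.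
Qed.

Lemma prox_in_argmin (f : H -> H -> R) (lambda : R) (x : H) :
  argmin C (prox_objective f lambda x) !=set0 ->
  argmin C (prox_objective f lambda x) (prox C f lambda x).
Proof. exact: xgetPex. Qed.

(** Each variational inequality is tested with the other minimizer; in the sum
    the quadratic parts combine into [<(a - b) - (x - y), b - a>]. *)
Lemma sqr_dist_argmin_prox (f : H -> H -> R) (lambda : R) (x y a b : H) :
  0 <= lambda -> convex_function C (f x) -> convex_function C (f y) ->
  argmin C (prox_objective f lambda x) a ->
  argmin C (prox_objective f lambda y) b ->
  `|a - b| ^+ 2 <=
    dot (x - y) (a - b) + lambda * (f x b - f x a + (f y a - f y b)).
Proof.
move=> lambda_ge0 fx_convex fy_convex a_min b_min.
have := argmin_prox_variational lambda_ge0 fx_convex a_min (proj1 b_min).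
have := argmin_prox_variational lambda_ge0 fy_convex b_min (proj1 a_min).
rewrite (sqr_norm_dot dot_norm) !(linearBl, linearBr) /= (dotC dot b a); lra.
Qed.

(** The factor [|x - y|] comes from the growth of the [alpha_i]; the factor
    [|(x - y) - (a - b)|] appears because antisymmetry of the [alpha_i] pairs
    them with a difference of values of [beta_i], taken at [x - a] and
    [y - b]. *)
Lemma strongly_lipschitz_type_bound (phi : H -> H -> R) :
  monotone_bifun C phi -> strongly_lipschitz_type dot C phi ->
  exists2 M : R, 0 < M & forall x y a b, C x -> C y -> C a -> C b ->
    phi x b - phi x a + (phi y a - phi y b)
      <= M * `|x - y| * `|(x - y) - (a - b)|.
Proof.
move=> phi_monotone [p [alpha [beta [K [L [p_ge1 KL_gt0 phi_lip ab_lip]]]]]].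
exists (\sum_(i < p) L i * K i).
  have LK_gt0 i : 0 < L i * K i by have [? ?] := KL_gt0 i; exact: mulr_gt0.
  rewrite (bigD1 (Ordinal p_ge1)) //= ltr_pwDl // sumr_ge0 // => i _.
  exact: ltW.
move=> x y a b Cx Cy Ca Cb.
have := phi_lip _ _ _ Cx Cy Cb; have := phi_lip _ _ _ Cy Cx Ca.
have := phi_monotone _ _ Cx Cy.
suff : - (\sum_(i < p) dot (alpha i x y) (beta i (y - b))
        + \sum_(i < p) dot (alpha i y x) (beta i (x - a)))
    <= (\sum_(i < p) L i * K i) * `|x - y| * `|x - y - (a - b)| by lra.
rewrite -big_split/= -sumrN -mulrA mulr_suml; apply: ler_sum => i _.
have [beta_lip alpha_lip alpha_anti] := ab_lip i.
have [K_gt0 L_gt0] := KL_gt0 i.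
have -> : alpha i y x = - alpha i x y.
  by apply/eqP; rewrite -addr_eq0 addrC alpha_anti.
rewrite linearNl /= -linearBr -linearNr opprB.
apply: (le_trans (dot_le_norm dot_norm _ _)).
have -> : L i * K i * (`|x - y| * `|x - y - (a - b)|) =
   (L i * `|x - y|) * (K i * `|x - y - (a - b)|) by ring.
apply: ler_pM => //; first exact: alpha_lip.
have -> : x - y - (a - b) = (x - a) - (y - b) by rewrite opprD addrACA -opprD.
apply: (beta_lip (x - a, y - b)).
by split => /=; [exists x => //; exists a | exists y => //; exists b].
Qed.

End Proximal.

Theorem theorem4 (R : realType) (H : completeNormedModType R)
    (dot : {dot H for idfun}) (dot_norm : induces_norm dot)
    (C : set H) (C_neq0 : C !=set0) (C_closed : closed C)
    (C_convex : convex_set C)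
    (phi : H -> H -> R)
    (phi_convex : forall x, C x -> convex_function C (phi x))
    (varphi : H -> R) (varphi_convex : convex_function C varphi)
    (f : H -> H -> R)
    (f_def : forall x y, C x -> C y -> f x y = phi x y + varphi y - varphi x)
    (qualification : interior C !=set0 \/
       forall x, C x -> exists2 z, C z & continuous_wrt_at C (phi x) z)
    (prox_exists : forall (x : H) (lambda : R), C x -> 0 < lambda ->
       argmin C (prox_objective f lambda x) !=set0)
    (phi_monotone : monotone_bifun C phi)
    (phi_lipschitz : strongly_lipschitz_type dot C phi)
    (eps : R) (eps_gt0 : 0 < eps) :
  exists2 lambda : R, 0 < lambda & eps_nonexpansive C eps (prox C f lambda).
Proof.
have f_convex x : C x -> convex_function C (f x).
  move=> Cx t u v uC vC.
  have tC : C (conv t (u : convex_lmodType H) v) by apply/set_mem/C_convex.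
  rewrite !f_def//; try exact: set_mem.
  have := phi_convex _ Cx t u v uC vC; have := varphi_convex t u v uC vC.
  rewrite !convRE /= /onem; lra.
have [M M_gt0 phi_bound] :=
  strongly_lipschitz_type_bound dot_norm phi_monotone phi_lipschitz.
pose q := Num.sqrt eps.
have q_gt0 : 0 < q by rewrite sqrtr_gt0.
have qE : q ^+ 2 = eps by rewrite sqr_sqrtr// ltW.
have lambda_gt0 : 0 < q / M by exact: divr_gt0.
exists (q / M) => // x y Cx Cy.
have a_min := prox_in_argmin (prox_exists _ _ Cx lambda_gt0).
have b_min := prox_in_argmin (prox_exists _ _ Cy lambda_gt0).
move: (prox C f (q / M) x) (prox C f (q / M) y) a_min b_min => a b a_min b_min.
have [[Ca _] [Cb _]] := (a_min, b_min).
have := sqr_dist_argmin_prox dot_norm C_convex (ltW lambda_gt0)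
  (f_convex _ Cx) (f_convex _ Cy) a_min b_min.
rewrite !f_def//.
have := ler_wpM2l (ltW lambda_gt0) (phi_bound _ _ _ _ Cx Cy Ca Cb).
have := sqr_normB dot_norm (x - y) (a - b).
rewrite -qE !mulrA divfK ?gt_eqF//.
move: `|x - y| `|a - b| `|x - y - (a - b)| (dot _ _) => u v w s.
(* The gap [(1 + q^2) u^2 - v^2] is at least this square. *)
have := sqr_ge0 (q * u - w).
nra.
Qed.
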